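(* Let $S\subseteq\mathbb{N}=\{0,1,2,\dots\}$, and let $\mathcal{P}_S(z)=\sum_{\lambda}q^{\lambda_1+\cdots+\lambda_\ell}z^{\ell}$ be the $q$-series of partitions with rises in $S$, the sum being over all finite sequences $\lambda=(\lambda_1,\dots,\lambda_\ell)$, $\ell\ge0$, of positive integers with $\lambda_{i+1}-\lambda_i\in S$ for all $1\le i<\ell$. Then $$\mathcal{P}_S(z)=1+\sum_{k=1}^{\infty}\frac{q^{\binom{k+1}{2}}}{1-q^k}\,(\mathcal{S}_{k-1})!(q)\,z^k,$$ where $\mathcal{S}_k(q)=\sum_{s\in S}q^{k(s-1)}$ and $(\mathcal{S}_k)!(q)=\mathcal{S}_k(q)\mathcal{S}_{k-1}(q)\cdots\mathcal{S}_1(q)$.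
   Context: The empty sequence and all one-term sequences are included in the sum defining $\mathcal{P}_S(z)$. The empty product convention $(\mathcal{S}_0)!(q)=1$ is used. If $0\in S$, $\mathcal{S}_k(q)$ is a formal Laurent series in $q$ (it contains the term $q^{-k}$); the identity is one of power series in $z$ with coefficients formal Laurent series in $q$. *)

(* Defs.v *)
From HB Require Import structures.
From mathcomp Require Import all_boot all_order all_algebra.
From mathcomp Require Import zify.
From mathcomp Require Import mathcomp_extra boolp classical_sets functions.
From mathcomp Require Import cardinality fsbigop.

Set Implicit Arguments.
Unset Strict Implicit.
Unset Printing Implicit Defensive.

Import Order.TTheory GRing.Theory Num.Theory.

Local Open Scope classical_set_scope.
Local Open Scope ring_scope.

Definition bounded_order (R : nzRingType) (f : int -> R) : Prop :=
  exists N : int, forall n, n < N -> f n = 0.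

(* [lcoef f n] is the coefficient of q ^ n. *)
Record laurent (R : nzRingType) := Laurent {
  lcoef :> int -> R;
  laurent_subproof : `[< bounded_order lcoef >]
}.

HB.instance Definition _ (R : nzRingType) := [isSub for @lcoef R].
HB.instance Definition _ (R : nzRingType) := [Choice of laurent R by <:].

Lemma laurentP (R : nzRingType) (f g : laurent R) : f =1 g <-> f = g.
Proof. by split=> [/funext fg|-> //]; apply: val_inj. Qed.

Lemma laurent_bounded (R : nzRingType) (f : laurent R) : bounded_order f.
Proof. exact/asboolP/(valP f). Qed.

Definition mklaurent (R : nzRingType) (f : int -> R) (h : bounded_order f) :
  laurent R := Laurent (asboolT h).

Section Zmodule.
Variable R : nzRingType.
Implicit Types f g : laurent R.

Lemma lmono_bounded (c : R) (d : int) :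
  bounded_order (fun n => if n == d then c else 0).
Proof. by exists d => n; rewrite lt_neqAle => /andP[/negPf ->]. Qed.

(* c q ^ d *)
Definition lmono (c : R) (d : int) := mklaurent (lmono_bounded c d).

Lemma lzero_bounded : bounded_order (fun=> 0 : R).
Proof. by exists 0. Qed.

Lemma lopp_bounded f : bounded_order (fun n => - f n).
Proof.
by have [N hN] := laurent_bounded f; exists N => n /hN ->; rewrite oppr0.
Qed.

Lemma ladd_bounded f g : bounded_order (fun n => f n + g n).
Proof.
have [N hN] := laurent_bounded f; have [M hM] := laurent_bounded g.
by exists (Order.min N M) => n; rewrite lt_min => /andP[/hN -> /hM ->]; rewrite addr0.
Qed.

Definition lzero := mklaurent lzero_bounded.
Definition lopp f := mklaurent (lopp_bounded f).
Definition ladd f g := mklaurent (ladd_bounded f g).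

Lemma laddA : associative ladd.
Proof. by move=> f g h; apply/laurentP => n /=; rewrite addrA. Qed.
Lemma laddC : commutative ladd.
Proof. by move=> f g; apply/laurentP => n /=; rewrite addrC. Qed.
Lemma ladd0 : left_id lzero ladd.
Proof. by move=> f; apply/laurentP => n /=; rewrite add0r. Qed.
Lemma laddN : left_inverse lzero lopp ladd.
Proof. by move=> f; apply/laurentP => n /=; rewrite addNr. Qed.

HB.instance Definition _ := GRing.isZmodule.Build (laurent R) laddA laddC ladd0 laddN.

Lemma lcoef0 n : (0 : laurent R) n = 0. Proof. by []. Qed.
Lemma lcoefD f g n : (f + g) n = f n + g n. Proof. by []. Qed.
Lemma lcoefN f n : (- f) n = - f n. Proof. by []. Qed.
Lemma lcoefB f g n : (f - g) n = f n - g n. Proof. by []. Qed.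

End Zmodule.

Section Ring.
Variable R : comNzRingType.
Implicit Types f g h : laurent R.

(* The convolution has only finitely many nonzero terms. *)
Definition lconv (f g : int -> R) (n : int) : R :=
  \sum_(i \in [set: int]) f i * g (n - i).

Definition low (a : int) (f : int -> R) := forall n, n < a -> f n = 0.

Lemma fsumT_seq (I : choiceType) (s : seq I) (F : I -> R) :
  uniq s -> (forall i, i \notin s -> F i = 0) ->
  \sum_(i \in [set: I]) F i = \sum_(i <- s) F i.
Proof.
move=> us Fs; rewrite [RHS]fsbig_seq //; apply/esym/fsbig_widen => [|i /= [_]].
  exact: subsetT.
by move/negP; exact: Fs.
Qed.

Lemma lconvE a b (f g : int -> R) m : low a f -> low b g ->
  lconv f g (a + b + m%:Z) = \sum_(i < m.+1) f (a + i%:Z) * g (b + (m - i)%N%:Z).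
Proof.
move=> fa gb; rewrite /lconv.
pose s := [seq a + i%:Z | i <- iota 0 m.+1].
have us : uniq s by rewrite map_inj_uniq ?iota_uniq // => i j /addrI [].
rewrite (fsumT_seq us).
- rewrite big_map -[iota 0 _]/(index_iota 0 m.+1) big_mkord.
  apply: eq_bigr => i _; congr (_ * g _); have := ltn_ord i; lia.
- move=> i /negP his.
  case: (ltP i a) => [/fa ->|ai]; first by rewrite mul0r.
  rewrite gb ?mulr0 //; rewrite ltNge; apply/negP => hb.
  apply: his; apply/mapP; exists `|i - a|%N; last by lia.
  by rewrite mem_iota; lia.
Qed.

Lemma low_lconv a b (f g : int -> R) : low a f -> low b g -> low (a + b) (lconv f g).
Proof.
move=> fa gb n hn; rewrite /lconv fsbig1 // => i _.
case: (ltP i a) => [/fa ->|ai]; first by rewrite mul0r.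
by rewrite gb ?mulr0 //; lia.
Qed.

Lemma lmul_bounded f g : bounded_order (lconv f g).
Proof.
have [a fa] := laurent_bounded f; have [b gb] := laurent_bounded g.
by exists (a + b); apply: low_lconv.
Qed.

Definition lmul f g := mklaurent (lmul_bounded f g).
Definition lone : laurent R := lmono 1 0.

Definition trunc (a : int) (f : int -> R) (m : nat) : {poly R} :=
  \poly_(i < m.+1) f (a + i%:Z).

Lemma lconv_poly a b (f g : int -> R) N m : low a f -> low b g -> (m <= N)%N ->
  lconv f g (a + b + m%:Z) = (trunc a f N * trunc b g N)`_m.
Proof.
move=> fa gb mN; rewrite (lconvE _ fa gb) coefM; apply: eq_bigr => i _.
by rewrite !coef_poly; have := ltn_ord i; case: ifP; case: ifP => //; lia.
Qed.

Lemma low_cases (a n : int) : (n < a) \/ exists m : nat, n = a + m%:Z.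
Proof. by case: (ltP n a) => h; [left|right; exists `|n - a|%N; lia]. Qed.

Lemma lmulC : commutative lmul.
Proof.
move=> f g; apply/laurentP => n /=.
have [a fa] := laurent_bounded f; have [b gb] := laurent_bounded g.
have [h|[m ->]] := low_cases (a + b) n.
  by rewrite (low_lconv fa gb h) (low_lconv gb fa) // addrC.
rewrite (lconv_poly fa gb (leqnn m)) mulrC.
by rewrite -(lconv_poly gb fa (leqnn m)) [b + a]addrC.
Qed.

Lemma lmulA : associative lmul.
Proof.
move=> f g h; apply/laurentP => n /=.
have [a fa] := laurent_bounded f; have [b gb] := laurent_bounded g.
have [c hc] := laurent_bounded h.
have fg := low_lconv fa gb; have gh := low_lconv gb hc.
have [k|[m ->]] := low_cases (a + b + c) n.
  by rewrite (low_lconv fg hc k) (low_lconv fa gh) // addrA.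
rewrite (lconv_poly fg hc (leqnn m)) -[a + b + c]addrA (lconv_poly fa gh (leqnn m)).
set P := trunc a f m; set Q := trunc b g m; set T := trunc c h m.
rewrite [LHS](_ : _ = (P * (Q * T))`_m); last first.
  rewrite [LHS]coefM [RHS]coefM; apply: eq_bigr => i _; congr (_ * _).
  by rewrite coef_poly ltnS leq_subr (lconv_poly gb hc (leq_subr i m)).
rewrite mulrA [LHS]coefM [RHS]coefM; apply: eq_bigr => i _; congr (_ * _).
by rewrite coef_poly (ltn_ord i) (@lconv_poly _ _ _ _ m) // -ltnS.
Qed.

Lemma lmono_conv c d (g : int -> R) n : lconv (lmono c d) g n = c * g (n - d).
Proof.
rewrite /lconv (@fsumT_seq _ [:: d]) //= ?big_seq1 ?eqxx //.
by move=> i; rewrite inE => /negPf ->; rewrite mul0r.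
Qed.

Lemma lmul1 : left_id lone lmul.
Proof. by move=> f; apply/laurentP => n /=; rewrite lmono_conv subr0 mul1r. Qed.

Lemma lmulDl : left_distributive lmul +%R.
Proof.
move=> f g h; apply/laurentP => n /=.
have [a fa] := laurent_bounded f; have [b gb] := laurent_bounded g.
have [c hc] := laurent_bounded h.
have fl : low (Order.min a b) f.
  by move=> k; rewrite lt_min => /andP[/fa].
have gl : low (Order.min a b) g.
  by move=> k; rewrite lt_min => /andP[_ /gb].
have fgl : low (Order.min a b) (f + g : laurent R).
  by move=> k hk; rewrite lcoefD fl ?gl ?addr0.
have [k|[m ->]] := low_cases (Order.min a b + c) n.
  by rewrite (low_lconv fgl hc) // (low_lconv fl hc) // (low_lconv gl hc) // addr0.
rewrite (lconvE _ fgl hc) (lconvE _ fl hc) (lconvE _ gl hc) -big_split /=.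
by apply: eq_bigr => i _; rewrite mulrDl.
Qed.

Lemma lone_neq0 : lone != 0.
Proof.
apply/eqP => /laurentP /(_ 0) /= /eqP.
by rewrite (negPf (oner_neq0 _)).
Qed.

HB.instance Definition _ := GRing.Zmodule_isComNzRing.Build (laurent R)
  lmulA lmulC lmul1 lmulDl lone_neq0.

Definition lunit : pred (laurent R) := fun f => `[< exists g, g * f = 1 >].
Definition linv f : laurent R :=
  if pselect (exists g, g * f = 1) is left e then projT1 (cid e) else f.

Lemma lmulV : {in lunit, left_inverse 1 linv *%R}.
Proof.
move=> f; rewrite unfold_in => /asboolP e; rewrite /linv.
by case: pselect => // e'; case: (cid e').
Qed.
Lemma lunitPl f g : g * f = 1 -> lunit f.
Proof. by move=> h; apply/asboolP; exists g. Qed.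
Lemma linv_out : {in [predC lunit], linv =1 id}.
Proof.
move=> f; rewrite inE => /asboolP ne; rewrite /linv.
by case: pselect => // e; case: ne.
Qed.

HB.instance Definition _ := GRing.ComNzRing_hasMulInverse.Build (laurent R)
  lmulV lunitPl linv_out.

Lemma lcoef1 n : (1 : laurent R) n = (n == 0)%:R.
Proof. by rewrite /= ; case: eqP. Qed.

Lemma lcoefM f g n : (f * g) n = \sum_(i \in [set: int]) f i * g (n - i).
Proof. by []. Qed.

Definition qvar : laurent R := lmono 1 1.

Lemma lmonoM c c' d d' : lmono c d * lmono c' d' = lmono (c * c') (d + d') :> laurent R.
Proof.
apply/laurentP => n; rewrite [LHS]lmono_conv /=.
have -> : (n - d == d') = (n == d + d') by lia.
by case: ifP; rewrite ?mulr0.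
Qed.

Lemma qvarV : lmono 1 (-1) * qvar = 1.
Proof. by rewrite lmonoM mul1r. Qed.

Lemma qvar_unit : qvar \is a GRing.unit.
Proof. by apply/unitrPr; exists (lmono 1 (-1)); rewrite mulrC qvarV. Qed.

Lemma qvarX n : qvar ^+ n = lmono 1 n%:Z.
Proof.
by elim: n => [|n IH]; rewrite ?exprS ?IH ?lmonoM ?mul1r //; congr lmono; lia.
Qed.

Lemma qvarXz (d : int) : qvar ^ d = lmono 1 d.
Proof.
case: (lerP 0 d) => hd.
  by rewrite -(gez0_abs hd) -exprnP qvarX.
have -> : d = - `|d|%N%:Z by lia.
rewrite -exprz_inv -exprnP.
have -> : qvar^-1 = lmono 1 (-1).
  by rewrite -[LHS]mul1r -qvarV mulrK // qvar_unit.
elim: `|d|%N => [|n IH]; first by rewrite expr0.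
by rewrite exprS IH lmonoM mul1r; congr lmono; lia.
Qed.

Lemma lcoef_qXz (d n : int) : (qvar ^ d) n = (n == d)%:R.
Proof. by rewrite qvarXz /=; case: eqP. Qed.

Definition lsummable (I : choiceType) (A : set I) (F : I -> laurent R) : Prop :=
  (forall n, finite_set (A `&` [set i | F i n != 0])) /\
  (exists N : int, forall i, A i -> low N (F i)).

(* The coefficientwise sum of a family that is [lsummable] (see [lcoef_lsum]);
   the value is meaningless for other families. *)
Definition lsum (I : choiceType) (A : set I) (F : I -> laurent R) : laurent R :=
  if pselect (bounded_order (fun n => \sum_(i \in A) F i n)) is left h
  then mklaurent h else 0.

Lemma lcoef_lsum (I : choiceType) (A : set I) (F : I -> laurent R) n :
  lsummable A F -> lsum A F n = \sum_(i \in A) F i n.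
Proof.
case=> _ [N hN]; rewrite /lsum; case: pselect => // -[].
by exists N => k hk; apply: fsbig1 => i /hN ->.
Qed.

End Ring.

Arguments qvar {R}.

(* Power series in z over [laurent R], as sequences of coefficients; [zmono c l] is
   c z ^ l and [zsum] is the coefficientwise sum. *)
Definition zseries (R : comNzRingType) := nat -> laurent R.

Definition zmono (R : comNzRingType) (c : laurent R) (l : nat) : zseries R :=
  fun m => if m == l then c else 0.

Definition zsum (R : comNzRingType) (I : choiceType) (A : set I)
    (F : I -> zseries R) : zseries R :=
  fun m => lsum A (fun i => F i m).

Definition zsummable (R : comNzRingType) (I : choiceType) (A : set I)
    (F : I -> zseries R) : Prop :=
  forall m, lsummable A (fun i => F i m).

Local Notation q := (qvar : laurent int).

Definition rises_in (S : set nat) : set (seq nat) :=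
  [set la | (forall i, (i < size la)%N -> (0 < nth 0%N la i)%N) /\
            (forall i, (i.+1 < size la)%N -> exists2 s, S s &
               (nth 0%N la i.+1)%:Z - (nth 0%N la i)%:Z = s%:Z)].

Definition partition_series (S : set nat) : zseries int :=
  zsum (rises_in S) (fun la => zmono (q ^+ sumn la) (size la)).

(* Only meaningful for 0 < k, or for finite S; see [rise_series_summable]. *)
Definition rise_series (S : set nat) (k : nat) : laurent int :=
  lsum S (fun s => q ^ (k%:Z * (s%:Z - 1))).

Definition rise_fact (S : set nat) (k : nat) : laurent int :=
  \prod_(1 <= i < k.+1) rise_series S i.

Lemma rise_series_summable (S : set nat) k : (0 < k)%N ->
  lsummable S (fun s => q ^ (k%:Z * (s%:Z - 1))).
Proof.
move=> k0; split=> [n|]; last first.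
  by exists (- k%:Z) => s _ n hn; rewrite lcoef_qXz; case: eqP => //; nia.
apply: (@sub_finite_set _ _ `I_(`|n|.+2)); last exact: finite_II.
by move=> s /= [_]; rewrite lcoef_qXz; case: (n =P _); rewrite ?eqxx // => -> _; nia.
Qed.

Lemma finite_bounded_seq (N l : nat) :
  finite_set [set la : seq nat | size la = l /\ all (fun x => x <= N)%N la].
Proof.
apply: (@sub_finite_set _ _
  ((fun t : l.-tuple 'I_N.+1 => map val t) @` setT)); last first.
  exact/finite_image/finite_finset.
move=> la /= [sl /allP al].
have sz : size (map (@inord N) la) == l by rewrite size_map sl.
exists (Tuple sz) => //=; rewrite -map_comp -[RHS]map_id.
by apply/eq_in_map => x /al xN /=; rewrite inordK.
Qed.

Lemma partition_series_summable (S : set nat) :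
  zsummable (rises_in S) (fun la => zmono (q ^+ sumn la) (size la)).
Proof.
move=> m; split=> [n|]; last first.
  exists 0 => la _ n hn; rewrite /zmono; case: ifP => // _.
  by rewrite exprnP lcoef_qXz; case: eqP => //; lia.
apply: sub_finite_set (finite_bounded_seq `|n| m) => la /= [_].
rewrite /zmono; case: (m =P _) => [->|_]; last by rewrite eqxx.
rewrite exprnP lcoef_qXz; case: (n =P _); rewrite ?eqxx // => -> _; split=> //.
apply/allP => x; rewrite absz_nat; elim: la => //= y la IH.
by rewrite inE => /predU1P[->|/IH]; lia.
Qed.

Lemma zmono_summable (R : comNzRingType) (A : set nat) (c : nat -> laurent R) :
  zsummable A (fun k => zmono (c k) k).
Proof.
move=> m; split=> [n|].
  apply: (@sub_finite_set _ _ [set m]); last exact: finite_set1.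
  by move=> k /= [_]; rewrite /zmono; case: (m =P k) => // _; rewrite eqxx.
have [N hN] := laurent_bounded (c m); exists N => k _ n hn.
by rewrite /zmono; case: (m =P k) => // <-; apply: hN.
Qed.

(* Main.v *)
(** Group the sequences by their first part.  If [H_k(a)] enumerates the sequences of
    length [k + 1] with first part [a], splitting according to the first rise [s] gives
    [H_(k+1)(a) = q^a * \sum_(s in S) H_k(a + s)], whence by induction
    [H_k(a) = q^((k+1) a + 'C(k+1, 2)) * (S_k)!(q)]; the sum over [a >= 1] is geometric. *)
Require Import Defs.
From mathcomp Require Import all_boot all_order all_algebra.
From mathcomp Require Import boolp classical_sets.
From mathcomp Require Import zify cardinality fsbigop.

Set Implicit Arguments.
Unset Strict Implicit.
Unset Printing Implicit Defensive.

Import Order.TTheory GRing.Theory Num.Theory.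

Local Open Scope classical_set_scope.
Local Open Scope ring_scope.

(** * Formal sums of Laurent series: regrouping, linearity *)

(** Once [C] is cut down to a list [s] of the support of [F], this is an exchange of two finite
    sums: each [x] in [s] is counted once, at the index [p x]. *)
Lemma fsbig_partition (V : nmodType) (I J : choiceType) (p : J -> I) (A : set I)
    (C : set J) (F : J -> V) :
  finite_set (C `&` [set x | F x != 0]) -> (forall x, C x -> A (p x)) ->
  \sum_(x \in C) F x = \sum_(i \in A) \sum_(x \in C `&` p @^-1` [set i]) F x.
Proof.
move=> /finite_seqP[s0 s0E] CA; pose s := undup s0.
have us : uniq s by exact: undup_uniq.
have sE x : (x \in s) <-> C x /\ F x != 0.
  rewrite mem_undup; have -> : (x \in s0) <-> [set` s0] x by [].
  by rewrite -s0E.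
have F0 x : C x -> x \notin s -> F x = 0.
  by move=> Cx /negP sx; apply/eqP/negPn/negP => Fx; apply/sx/sE.
have fibre i : \sum_(x \in C `&` p @^-1` [set i]) F x = \sum_(x <- s | p x == i) F x.
  rewrite -[RHS]big_filter; apply/esym; rewrite [LHS]fsbig_seq ?filter_uniq //.
  apply: fsbig_widen => x /=; rewrite mem_filter.
    by move=> /andP[/eqP pi /sE[Cx _]].
  by move=> [[Cx /= ->]]; rewrite eqxx /= => /negP /(F0 _ Cx).
under [RHS]eq_fsbigr do rewrite fibre.
have -> : \sum_(x \in C) F x = \sum_(x <- s) F x.
  apply/esym; rewrite [LHS]fsbig_seq //; apply: fsbig_widen => x /=.
    by move=> /sE[].
  by move=> [Cx /negP /(F0 _ Cx)].
(* For an index outside this list the fibre misses the support, so its inner sum is zero and [A] may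
   be infinite. *)
transitivity (\sum_(i <- undup (map p s)) \sum_(x <- s | p x == i) F x); last first.
  rewrite [LHS]fsbig_seq ?undup_uniq //; apply: fsbig_widen => i /=.
    by rewrite mem_undup => /mapP[x /sE[Cx _] ->]; exact: CA.
  move=> [_ /negP]; rewrite mem_undup => ni; apply: big1_seq => x /andP[/eqP pi xs].
  by case/negP: ni; rewrite -pi map_f.
rewrite (exchange_big_dep xpredT) //= big_seq [RHS]big_seq; apply: eq_bigr => x xs.
under eq_bigl do rewrite eq_sym.
by rewrite -big_filter filter_pred1_uniq ?big_seq1 ?undup_uniq // mem_undup map_f.
Qed.

Section LaurentSums.
Variable R : comNzRingType.
Implicit Types (I J : choiceType) (c : laurent R).

(** [lsum] depends on its family only through the coefficient sums; these also decide whether its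
    default value 0 is taken. *)
Lemma eq_lsum I J (A : set I) (B : set J) (F : I -> laurent R) (G : J -> laurent R) :
  (forall n, \sum_(i \in A) F i n = \sum_(j \in B) G j n) -> lsum A F = lsum B G.
Proof.
move=> FG; rewrite /lsum; have -> : (fun n => \sum_(i \in A) F i n) =
  (fun n => \sum_(j \in B) G j n) by exact/funext.
by case: pselect => // h; apply/laurentP => n.
Qed.

Lemma eq_lsumr I (A : set I) (F G : I -> laurent R) :
  (forall i, A i -> F i = G i) -> lsum A F = lsum A G.
Proof.
by move=> FG; apply: eq_lsum => n; apply: eq_fsbigr => i /set_mem /FG ->.
Qed.

Lemma lsum_widen I (A B : set I) (F : I -> laurent R) :
  A `<=` B -> (forall i, B i -> ~ A i -> F i = 0) -> lsum A F = lsum B F.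
Proof.
move=> AB F0; apply: eq_lsum => n; apply: fsbig_widen => // i [Bi nAi] /=.
by rewrite F0.
Qed.

Lemma lsum_image I J (h : I -> J) (A : set I) (F : J -> laurent R) :
  injective h -> lsum (h @` A) F = lsum A (F \o h).
Proof.
by move=> ih; apply: eq_lsum => n; apply: fsbig_image => x y _ _ /ih.
Qed.

Lemma lsum_set1 I (x : I) (F : I -> laurent R) : lsum [set x] F = F x.
Proof.
rewrite /lsum; case: pselect => [h|[]].
  by apply/laurentP => n /=; rewrite fsbig_set1.
have [N hN] := laurent_bounded (F x).
by exists N => n /hN; rewrite fsbig_set1.
Qed.

Lemma sub_lsummable I (A B : set I) (F : I -> laurent R) :
  A `<=` B -> lsummable B F -> lsummable A F.
Proof.
move=> AB [fB [N hN]]; split=> [n|]; last by exists N => i /AB /hN.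
by apply: sub_finite_set (fB n) => i [/AB].
Qed.

Lemma eq_lsummable I (A : set I) (F G : I -> laurent R) :
  (forall i, A i -> F i = G i) -> lsummable A F -> lsummable A G.
Proof.
move=> FG [fF [N hN]]; split=> [n|]; last by exists N => i Ai; rewrite -FG //; exact: hN.
by apply: sub_finite_set (fF n) => i [Ai /=]; rewrite -FG.
Qed.

(** Each fibre inherits summability from [C], so the inner sums can be read off coefficientwise and
    [fsbig_partition] applies in every degree. *)
Lemma lsum_partition I J (p : J -> I) (A : set I) (C : set J)
    (F : J -> laurent R) :
  lsummable C F -> (forall x, C x -> A (p x)) ->
  lsum C F = lsum A (fun i => lsum (C `&` p @^-1` [set i]) F).
Proof.
move=> sF CA; apply: eq_lsum => n.
rewrite (fsbig_partition (proj1 sF n) CA).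
apply: eq_fsbigr => i _; rewrite lcoef_lsum //.
by apply: sub_lsummable sF => x [].
Qed.

(** If [c] starts in degree [a] and all [F i] start in degree [N] or later, the coefficient of
    [c * F i] in degree [a + N + m] involves only the degrees [N] to [N + m] of [F i]. Finitely many
    [i] have a nonzero coefficient there, so two finite sums are exchanged. *)
Lemma lsumMr I (A : set I) c (F : I -> laurent R) :
  lsummable A F -> c * lsum A F = lsum A (fun i => c * F i).
Proof.
move=> sF; have [fF [N hN]] := sF; have [a ca] := laurent_bounded c.
have low_sum : low N (lsum A F).
  by move=> n hn; rewrite lcoef_lsum //; apply: fsbig1 => i /hN; apply.
have low_mul i : A i -> low (a + N) (c * F i).
  by move=> /hN hi; exact: low_lconv.
have coefE m : \sum_(i \in A) (c * F i) (a + N + m%:Z) =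
    \sum_(j < m.+1) c (a + j%:Z) * lsum A F (N + (m - j)%N%:Z).
  (* One list [s] serves all the degrees [N] to [N + m] at once. *)
  have : finite_set (\bigcup_(j in `I_m.+1) (A `&` [set i | F i (N + j%:Z) != 0])).
    by apply: bigcup_finite => [|j _]; [exact: finite_II | exact: fF].
  move=> /finite_seqP[s0 s0E]; pose s := undup s0.
  have us : uniq s by exact: undup_uniq.
  have sE x : (x \in s) <-> exists2 j, (j < m.+1)%N & A x /\ F x (N + j%:Z) != 0.
    rewrite mem_undup; have -> : (x \in s0) <-> [set` s0] x by [].
    by rewrite -s0E.
  have sA : [set` s] `<=` A by move=> x /= /sE[j _ []].
  have F0 x j : A x -> x \notin s -> (j <= m)%N -> F x (N + j%:Z) = 0.
    move=> Ax /negP sx jm; apply/eqP/negPn/negP => Fx; apply/sx/sE.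
    by exists j.
  have convE x : A x -> (c * F x) (a + N + m%:Z) =
      \sum_(j < m.+1) c (a + j%:Z) * F x (N + (m - j)%N%:Z).
    by move=> /hN; exact: lconvE.
  have toseq (g : I -> R) : (forall x, A x -> x \notin s -> g x = 0) ->
      \sum_(i \in A) g i = \sum_(i <- s) g i.
    move=> g0; apply/esym; rewrite [LHS]fsbig_seq //; apply: fsbig_widen => // x /=.
    by move=> [Ax /negP]; exact: g0.
  rewrite toseq; last first.
    move=> x Ax xs; rewrite convE // big1 // => j _.
    by rewrite F0 ?mulr0 ?leq_subr.
  rewrite big_seq (eq_bigr (fun x =>
      \sum_(j < m.+1) c (a + j%:Z) * F x (N + (m - j)%N%:Z))); last first.
    by move=> x xs; rewrite convE //; exact: sA.
  rewrite -big_seq exchange_big /=; apply: eq_bigr => j _.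
  rewrite -mulr_sumr lcoef_lsum // toseq // => x Ax xs.
  by rewrite F0 ?leq_subr.
have coefE' n : (c * lsum A F) n = \sum_(i \in A) (c * F i) n.
  have [h|[m ->]] := low_cases (a + N) n.
    by rewrite fsbig1 => [|i /low_mul]; [exact: low_lconv h | exact].
  by rewrite coefE; exact: lconvE.
(* The order bound that [lsum] asks for on the right is that of the product on the left. *)
rewrite [RHS]/lsum; case: pselect => [h|[]]; first by apply/laurentP => n; rewrite coefE'.
have [M hM] := laurent_bounded (c * lsum A F); exists M => n hn.
by rewrite -coefE' hM.
Qed.

(** * The geometric series *)

Lemma geometric_lsummable k : (0 < k)%N ->
  lsummable [set a | (1 <= a)%N] (fun a => qvar ^+ (k * a) : laurent R).
Proof.
move=> k0; split=> [n|].
  apply: (@sub_finite_set _ _ `I_(`|n|.+1)); last exact: finite_II.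
  move=> a /= [_]; rewrite exprnP lcoef_qXz; case: (n =P _); rewrite ?eqxx // => -> _.
  nia.
by exists 0 => a _ n hn; rewrite exprnP lcoef_qXz; case: eqP => //; lia.
Qed.

Lemma lsumD1 I (x : I) (A : set I) (F : I -> laurent R) :
  lsummable A F -> A x -> lsum A F = F x + lsum (A `\ x) F.
Proof.
move=> sF Ax; have sF' : lsummable (A `\ x) F by apply: sub_lsummable sF => i [].
apply/laurentP => n; rewrite lcoefD !lcoef_lsum //.
(* The index [x] is adjoined because [F x] may vanish in degree [n], while splitting off its term
   requires [x] to lie in the finite set. *)
pose X := x |` (A `&` [set i | F i n != 0]).
have fX : finite_set X by rewrite finite_setU; split=> //; exact: (proj1 sF).
have F0 i : A i -> ~ X i -> F i n = 0.
  by move=> Ai nX; apply/eqP/negPn/negP => Fi; apply: nX; right.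
rewrite -(@fsbig_widen _ _ _ _ X).
- rewrite (fsbigD1 x) //; last by left.
  congr (_ + _); apply: fsbig_widen => i /=; first by move=> [[//|[]]].
  by move=> [[Ai ix] nX]; apply: F0 => // Xi; apply: nX.
- by move=> i [->|[]].
- by move=> i [] /F0.
Qed.

(** Shifting the index by one gives G = q^k + q^k G, hence G (1 - q^k) = q^k. *)
Lemma geometric_lsum k : (0 < k)%N ->
  lsum [set a | (1 <= a)%N] (fun a => qvar ^+ (k * a)) =
  qvar ^+ k / (1 - qvar ^+ k) :> laurent R.
Proof.
move=> k0; have sG := geometric_lsummable k0; set A := [set a | _].
have GE : lsum A (fun a => qvar ^+ (k * a)) =
    qvar ^+ k + qvar ^+ k * lsum A (fun a => qvar ^+ (k * a)) :> laurent R.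
  rewrite {1}(@lsumD1 _ 1%N) // muln1; congr (_ + _); rewrite lsumMr //.
  have -> : A `\ 1%N = succn @` A.
    apply/seteqP; split=> [[|a] [/= a1 an1]|_ [a /= a1 <-]] //.
      by exists a => //=; case: a an1 {a1}.
    by split=> //= -[a0]; rewrite a0 in a1.
  rewrite lsum_image; last exact: succn_inj.
  by apply: eq_lsumr => a _ /=; rewrite mulnS exprD.
set G := lsum A _ in GE *.
have GB : G * (1 - qvar ^+ k) = qvar ^+ k.
  by rewrite mulrBr mulr1 {1}GE [G * _]mulrC addrK.
(* Dividing by [1 - qvar ^+ k] is legitimate only for a unit, since the inverse of a non-unit is a
   default value. The same equation supplies the inverse G / q^k, as q^k is invertible. *)
suff u : 1 - qvar ^+ k \is a @GRing.unit (laurent R) by rewrite -{1}GB mulrK.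
have qu : qvar ^+ k \is a @GRing.unit (laurent R) by rewrite unitrX ?qvar_unit.
by apply/unitrPr; exists (G / qvar ^+ k); rewrite mulrA [_ * G]mulrC GB divrr.
Qed.

Lemma zsum_zmono (A : set nat) (c : nat -> laurent R) m :
  A m -> zsum A (fun k => zmono (c k) k) m = c m.
Proof.
move=> Am; rewrite /zsum -(@lsum_widen _ [set m]) ?lsum_set1 /zmono ?eqxx //.
  by move=> _ ->.
by move=> k _ km; case: eqP => // mk; case: km.
Qed.

End LaurentSums.

(** * Sequences with rises in [S], by length and first part *)

Section Rises.
Variable S : set nat.
Local Notation q := (qvar : laurent int).

Lemma rises_in_cons2 a b l : rises_in S [:: a, b & l] <->
  [/\ (0 < a)%N, exists2 s, S s & b = (a + s)%N & rises_in S (b :: l)].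
Proof.
split=> [[pos rise]|[a0 [s Ss bE] [pos rise]]].
  split; first exact: (pos 0%N).
    by have /= [//|s Ss h] := rise 0%N; exists s => //; lia.
  by split=> i hi; [exact: (pos i.+1) | exact: (rise i.+1)].
split=> [[|i] //= hi|[|i] //= hi]; first exact: pos.
  by exists s => //; lia.
exact: rise.
Qed.

Lemma rises_in_seq1 a : rises_in S [:: a] <-> (0 < a)%N.
Proof.
split=> [[pos _]|a0]; first exact: (pos 0%N).
by split=> [[|i]|i] //=; rewrite ltnS.
Qed.

(** The index [k] counts rises, so the length is [k.+1]; the sequence is never empty and [nth] does
    not return its default here. *)
Definition rises_from k a : set (seq nat) :=
  [set la | [/\ rises_in S la, size la = k.+1 & nth 0%N la 0 = a]].

(** This is a subfamily of the one that gives the coefficient of z^(k+1) in the partition series. *)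
Lemma rises_from_summable k a :
  lsummable (rises_from k a) (fun la => q ^+ sumn la).
Proof.
apply: (eq_lsummable _ (sub_lsummable _ (partition_series_summable S k.+1))).
  by move=> la [_ sz _]; rewrite /zmono sz eqxx.
by move=> la [].
Qed.

Lemma rises_from0 a : (0 < a)%N -> rises_from 0 a = [set [:: a]].
Proof.
move=> a0; apply/seteqP; split=> [[|b [|c l]] [] //= _ _ -> //|_ ->].
by split=> //; apply/rises_in_seq1.
Qed.

Lemma rises_fromS k a s : (0 < a)%N -> S s ->
  rises_from k.+1 a `&` (fun la => nth 0%N la 1 - nth 0%N la 0)%N @^-1` [set s] =
  cons a @` rises_from k (a + s).
Proof.
move=> a0 Ss; apply/seteqP; split.
  move=> [|b [|c l]] [[rla sz ba] cb] //; rewrite /= in ba cb.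
  (* The equation [cE] shows that the subtraction in [nat] defining the fibre is not truncated, so
     the first rise really is [s]. *)
  have [b0 [t St cE] rl] := (rises_in_cons2 _ _ _).1 rla.
  exists (c :: l); last by rewrite -ba.
  by split=> /=; [exact: rl | case: sz => -> | lia].
move=> _ [[|c l] [rl szl ch] <-] //.
rewrite /= in szl ch; split=> /=; last by rewrite ch; lia.
split=> //=; last by rewrite szl.
by apply/rises_in_cons2; split=> //; exists s.
Qed.

Lemma rises_from_sum k a : (0 < a)%N ->
  lsum (rises_from k a) (fun la => q ^+ sumn la) =
  q ^+ (k.+1 * a + 'C(k.+1, 2)) * rise_fact S k.
Proof.
elim: k a => [|k IH] a a0.
  by rewrite rises_from0 // lsum_set1 /rise_fact big_nil mulr1 bin_small // mul1n.
pose p (la : seq nat) := (nth 0%N la 1 - nth 0%N la 0)%N.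
rewrite (@lsum_partition _ _ _ p S); first last.
- move=> [|b [|c l]] [rla sz _] //.
  have [_ [s Ss cE] _] := (rises_in_cons2 _ _ _).1 rla.
  by rewrite /p /= cE addKn.
- exact: rises_from_summable.
rewrite /rise_fact big_nat_recr //= -/(rise_fact S k) mulrA /rise_series lsumMr; last first.
  exact: rise_series_summable.
apply: eq_lsumr => s Ss; rewrite rises_fromS // lsum_image; last by move=> l l' [].
rewrite (@eq_lsumr _ _ _ _ (fun la => q ^+ a * q ^+ sumn la)); last first.
  by move=> la _; rewrite -exprD.
rewrite -lsumMr; last exact: rises_from_summable.
rewrite IH; last by rewrite addn_gt0 a0.
rewrite mulrA [RHS]mulrAC; congr (_ * _).
(* Exponents are compared in [int], because [s - 1] is negative for [s = 0]. The [- k.+1] in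
   [k.+1 * (s - 1)] cancels the [k.+1] by which ['C(k.+2, 2)] exceeds ['C(k.+1, 2)]. *)
rewrite -exprD !exprnP !qvarXz lmonoM mulr1; congr lmono.
rewrite [in RHS]binS bin1; nia.
Qed.

Lemma rises_in_sum k :
  partition_series S k.+1 = q ^+ 'C(k.+2, 2) / (1 - q ^+ k.+1) * rise_fact S k.
Proof.
rewrite /partition_series /zsum.
pose C := rises_in S `&` [set la | size la = k.+1].
have CA la : C la -> [set a | (1 <= a)%N] (nth 0%N la 0).
  by case: la => [[]|a l [[pos _] _]] //; exact: (pos 0%N).
have FE la : C la -> q ^+ sumn la = zmono (q ^+ sumn la) (size la) k.+1.
  by move=> [_ sz]; rewrite /zmono sz eqxx.
(* Sequences of any other length contribute zero to the coefficient of z^(k+1). *)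
rewrite -(@lsum_widen _ _ C); first last.
- move=> la rla nC; rewrite /zmono; case: eqP => // sz.
  by exfalso; apply: nC; split.
- by move=> la [].
rewrite -(eq_lsumr FE) (lsum_partition _ CA).
- rewrite (@eq_lsumr _ _ _ _
    (fun a => q ^+ 'C(k.+1, 2) * rise_fact S k * q ^+ (k.+1 * a))); last first.
    move=> a a0; rewrite mulrAC -exprD addnC -rises_from_sum //; congr lsum.
    by apply/seteqP; split=> la /=; [move=> [[]] | move=> []].
  rewrite -lsumMr ?geometric_lsum //; last exact: geometric_lsummable.
  (* The numerator q^(k+1) of the geometric sum raises the exponent from ['C(k.+1, 2)] to
     ['C(k.+2, 2)]. *)
  by rewrite mulrAC mulrA -exprD [in RHS]binS bin1.
- apply: (eq_lsummable _ (sub_lsummable _ (partition_series_summable S k.+1))).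
    by move=> la /FE.
  by move=> la [].
Qed.

End Rises.

Theorem theorem24 (S : set nat) :
  partition_series S =
    zmono 1 0 \+ zsum [set k : nat | (1 <= k)%N]
      (fun k => zmono (qvar ^+ 'C(k.+1, 2) / (1 - qvar ^+ k) * rise_fact S k.-1) k).
Proof.
apply/funext => -[|k]; rewrite /GRing.add_fun /=; last first.
  by rewrite rises_in_sum zsum_zmono // /zmono /= add0r.
rewrite /partition_series /zsum.
(* Constant term in z: the sum on the right starts at [k = 1], so all its terms vanish in this
   degree. *)
rewrite [X in _ + X](_ : _ = 0); last first.
  rewrite -(@lsum_widen _ _ set0) //.
    by apply/laurentP => n; rewrite lcoef_lsum ?fsbig_set0 //; split=> [m|];
      [rewrite set0I; exact: finite_set0 | exists 0].
  by move=> [|k].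
(* On the left only the empty sequence has length 0, and it contributes q^0 = 1. *)
rewrite addr0 -(@lsum_widen _ _ [set [::]]) ?lsum_set1 // => [_ ->|[|a la] _ //].
  by split.
by move=> ne; case: ne.
Qed.
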